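(* Let $d\ge 1$, let $T>0$, let $\Omega\subset\mathbb{R}^d$ be a bounded open domain, and let $\mathbf{A}:\mathbb{R}^d\times[0,T]\to\mathbb{R}^d$ be continuous with continuous first-order partial derivatives and with $\sup_{\mathbf{x}\in\mathbb{R}^d,\,t\in[0,T]}\|\nabla_{\mathbf{x}}\mathbf{A}(\mathbf{x},t)\|_{\mathrm{op}}\le L_A$ for some constant $L_A>0$. Let $\widetilde{\Omega}(t)=\operatorname{D}^{\mathbf{A}}_{T\to t}(\Omega)$ and let $\widetilde{U}_0\in L^2(\widetilde{\Omega}(0))$. Then the solution of the integral invariant model with initial data $\widetilde{U}_0$ is unique: if $U$ and $V$ are both solutions of the integral invariant model with initial data $\widetilde{U}_0$, then for every $t\in[0,T]$ one has $U(\cdot,t)=V(\cdot,t)$ almost everywhere in $\widetilde{\Omega}(t)$.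
   Context: All functions are real-valued. $\nabla_{\mathbf{x}}\mathbf{A}$ is the spatial Jacobian matrix and $\|\cdot\|_{\mathrm{op}}$ is the operator norm induced by the Euclidean norm. Flow map. Under the stated assumptions on $\mathbf{A}$, for all $t_1,t_2\in[0,T]$ the map $\operatorname{D}^{\mathbf{A}}_{t_1\to t_2}:\mathbb{R}^d\to\mathbb{R}^d$ is defined by $\operatorname{D}^{\mathbf{A}}_{t_1\to t_2}(\mathbf{x})=\mathbf{s}(t_2)=\mathbf{x}+\int_{t_1}^{t_2}\mathbf{A}(\mathbf{s}(\tau),\tau)\,\mathrm{d}\tau$, where $\mathbf{s}$ is the solution on $[0,T]$ of $\frac{\mathrm{d}\mathbf{s}}{\mathrm{d}\tau}=\mathbf{A}(\mathbf{s},\tau)$ with $\mathbf{s}(t_1)=\mathbf{x}$. It is invertible with inverse $\operatorname{D}^{\mathbf{A}}_{t_2\to t_1}$. Function spaces. $H(G)$ denotes $L^2(G)$ with the $L^2$-inner product. $H_0(\Omega)=\{f\in L^2(\mathbb{R}^d):\operatorname{supp} f\subset\subset\Omega\}$ (the support is a compact subset of $\Omega$). $L^1([0,T],H(\widetilde{\Omega}(t)))$ is the set of $U$ such that $U(\cdot,t)\in L^2(\widetilde{\Omega}(t))$ for every $t\in[0,T]$ and the map $t\mapsto\|U(\cdot,t)\|_{L^2(\widetilde{\Omega}(t))}$ belongs to $L^1([0,T])$. Test functions. For $\Psi\in H_0(\Omega)$ and $t\in[0,T]$, $\psi(\mathbf{x},t)=\operatorname{\Phi}^{\mathbf{A}}_{T\to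 t}[\Psi](\mathbf{x}):=\Psi(\operatorname{D}^{\mathbf{A}}_{t\to T}(\mathbf{x}))$ for $\mathbf{x}\in\widetilde{\Omega}(t)$. Solution of the integral invariant model. Given $\widetilde{U}_0\in L^2(\widetilde{\Omega}(0))$ (extended by zero to $\mathbb{R}^d$), a function $U\in L^1([0,T],H(\widetilde{\Omega}(t)))$ is a solution of the integral invariant model with initial data $\widetilde{U}_0$ if $U(\cdot,0)=\widetilde{U}_0$ in $\widetilde{\Omega}(0)$ and, for every $\Psi\in H_0(\Omega)$, with $\psi(\mathbf{x},t)=\Psi(\operatorname{D}^{\mathbf{A}}_{t\to T}(\mathbf{x}))$ for $\mathbf{x}\in\widetilde{\Omega}(t)$, $t\in[0,T]$, one has $\frac{\mathrm{d}}{\mathrm{d}t}\int_{\widetilde{\Omega}(t)}U(\mathbf{x},t)\psi(\mathbf{x},t)\,\mathrm{d}\mathbf{x}=0$ on $[0,T]$; equivalently, $\int_{\widetilde{\Omega}(t)}U(\mathbf{x},t)\psi(\mathbf{x},t)\,\mathrm{d}\mathbf{x}=\int_{\widetilde{\Omega}(0)}\widetilde{U}_0(\mathbf{x})\psi(\mathbf{x},0)\,\mathrm{d}\mathbf{x}$ for all $t\in[0,T]$. Equality of $L^2$ functions is almost-everywhere equality. *)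

(* Defs.v *)
From HB Require Import structures.
From mathcomp Require Import all_boot all_order all_algebra.
From mathcomp Require Import all_classical all_reals all_analysis.
From mathcomp Require Import lra.

Set Implicit Arguments.
Unset Strict Implicit.
Unset Printing Implicit Defensive.

Import Order.TTheory GRing.Theory Num.Theory numFieldNormedType.Exports.

Local Open Scope classical_set_scope.
Local Open Scope ring_scope.

Definition rV_display : measure_display.
Proof. exact: default_measure_display. Qed.

Section borel_rV.
Variables (R : realType) (m n : nat).
Let borel : set (set 'M[R]_(m, n)) := <<s [set A | open A] >>.
Let borel0 : borel set0. Proof. exact: sigma_algebra0. Qed.
Let borelC A : borel A -> borel (~` A). Proof. exact: sigma_algebraC. Qed.
Let borel_bigcup (F : (set 'M[R]_(m, n))^nat) :
  (forall i, borel (F i)) -> borel (\bigcup_i F i).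
Proof. exact: sigma_algebra_bigcup. Qed.
HB.instance Definition _ := @isMeasurable.Build rV_display 'M[R]_(m, n)
  borel borel0 borelC borel_bigcup.
End borel_rV.

Lemma open_measurable_rV (R : realType) m n (A : set 'M[R]_(m, n)) :
  open A -> measurable A.
Proof. by move=> oA; apply: sub_sigma_algebra. Qed.

Lemma measurable_coord (R : realType) m n (i : 'I_m) (j : 'I_n) :
  measurable_fun setT (fun x : 'M[R]_(m, n) => x i j).
Proof.
apply: (measurability _ (measurable_realfun.RGenOpens.measurableE R)).
move=> _ [_ [a [b ->]] <-]; rewrite setTI; apply: open_measurable_rV.
by apply: open_comp => [x _|]; [exact: coord_continuous|exact: interval_open].
Qed.

Lemma measurable_box (R : realType) n (A : 'I_n -> set R) :
  (forall j, measurable (A j)) ->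
  measurable [set x : 'rV[R]_n | forall j, A j (x ord0 j)].
Proof.
move=> mA; rewrite (_ : mkset _ =
    \big[setI/setT]_(j < n) ((fun x : 'rV[R]_n => x ord0 j) @^-1` A j)).
  apply: bigsetI_measurable => j _.
  by rewrite -[X in measurable X]setTI; exact: measurable_coord.
apply/seteqP; split=> x; rewrite -bigcap_seq /=; first by move=> + j _; exact.
by move=> + j => /(_ j (mem_index_enum j)).
Qed.

Lemma measurable_fun_rV d (T : measurableType d) (R : realType) n
    (f : T -> 'rV[R]_n) :
  (forall j, measurable_fun setT (fun x => f x ord0 j)) ->
  measurable_fun setT f.
Proof.
move=> mf; apply: (measurability [set A : set 'rV[R]_n | open A] erefl).
move=> _ [U /= oU <-]; rewrite setTI.
(* an open set is a countable union of boxes with rational end points *)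
pose box (q : {ffun 'I_n -> rat * rat}) : set 'rV[R]_n :=
  [set y | forall j, ratr (q j).1 < y ord0 j < ratr (q j).2].
have -> : U = \bigcup_(q in [set q | box q `<=` U]) box q.
  apply/seteqP; split=> [y Uy|y [q qU qy]]; last exact: qU.
  move: oU; rewrite openE => /(_ _ Uy) /nbhs_ballP[e /= e0 eU].
  have ex j : exists q : rat * rat,
      [/\ y ord0 j - e < ratr q.1, ratr q.1 < y ord0 j,
          y ord0 j < ratr q.2 & ratr q.2 < y ord0 j + e].
    have [p] : exists p : rat, ratr p \in `]y ord0 j - e, y ord0 j[.
      by apply: rat_in_itvoo; rewrite ltrBlDr ltrDl.
    have [p'] : exists p : rat, ratr p \in `]y ord0 j, y ord0 j + e[.
      by apply: rat_in_itvoo; rewrite ltrDl.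
    rewrite !in_itv/= => /andP[? ?] /andP[? ?]; by exists (p, p').
  pose q : {ffun 'I_n -> rat * rat} := [ffun j => projT1 (cid (ex j))].
  exists q; last first.
    by move=> j; rewrite /q ffunE; case: cid => -[a b] [/= ? -> -> ?].
  move=> z /= qz; apply: eU; split=> // i j; rewrite !ord1.
  move: (qz j); rewrite /q ffunE; case: cid => -[a b] [/= ? ? ? ?] /andP[? ?].
  by rewrite /ball/= ltr_norml; apply/andP; split; lra.
rewrite preimage_bigcup (_ : \bigcup_(q in _) _ =
  \bigcup_q if `[< box q `<=` U >] then f @^-1` box q else set0); last first.
  apply/seteqP; split=> [x [q qU fxq]|x [q _]].
    by exists q => //; case: asboolP.
  by case: asboolP => // qU fxq; exists q.
apply: countable_bigcupT_measurable => // q; case: ifPn => // _.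
rewrite (_ : f @^-1` _ = \big[setI/setT]_(j < n)
    ((fun x => f x ord0 j) @^-1` `]ratr (q j).1, ratr (q j).2[)).
  apply: bigsetI_measurable => j _.
  by rewrite -[X in measurable X]setTI; apply: mf.
apply/seteqP; split=> x; rewrite -bigcap_seq /=.
  by move=> + j _; move=> /(_ j); rewrite /= in_itv.
by move=> + j => /(_ j (mem_index_enum j)); rewrite /= in_itv.
Qed.

(* The library proves this but registers no usable instance of it. *)
Lemma sigma_finite_product d1 d2 (T1 : measurableType d1)
    (T2 : measurableType d2) (R : realType)
    (m1 : {sigma_finite_measure set T1 -> \bar R})
    (m2 : {sigma_finite_measure set T2 -> \bar R}) :
  sigma_finite setT (m1 \x m2)%E.
Proof.
have /sigma_finiteP[F [TF ndF Foo]] := sigma_finiteT m1.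
have /sigma_finiteP[G [TG ndG Goo]] := sigma_finiteT m2.
exists (fun n => F n `*` G n) => [|k].
  rewrite -setXTT TF TG predeqE => -[x y]; split.
    move=> [/= [n _ Fnx] [k _ Gky]]; exists (maxn n k) => //; split.
    - by move: x Fnx; exact/subsetPset/ndF/leq_maxl.
    - by move: y Gky; exact/subsetPset/ndG/leq_maxr.
  by move=> [n _ []/= ? ?]; split; exists n.
have [? ?] := Foo k; have [? ?] := Goo k.
split; first exact: measurableX.
by rewrite product_measure1E// lte_mul_pinfty// ge0_fin_numE.
Qed.

Section lebesgue_rV.
Variable R : realType.

Definition cons_rV d (p : R * 'rV[R]_d) : 'rV[R]_d.+1 :=
  \row_j oapp (p.2 ord0) p.1 (unlift ord0 j).

Lemma measurable_cons_rV d : measurable_fun setT (@cons_rV d).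
Proof.
apply: measurable_fun_rV => j; case: (unliftP ord0 j) => [k|] ->.
  under eq_fun do rewrite mxE liftK /=.
  apply: (measurableT_comp (measurable_coord ord0 k)).
  exact: measurable_snd.
by under eq_fun do rewrite mxE unlift_none /=; exact: measurable_fst.
Qed.

Definition uncons_rV d (x : 'rV[R]_d.+1) : R * 'rV[R]_d :=
  (x ord0 ord0, \row_j x ord0 (lift ord0 j)).

Lemma cons_rVK d : cancel (@cons_rV d) (@uncons_rV d).
Proof.
move=> [a y]; rewrite /uncons_rV mxE unlift_none; congr (_, _).
by apply/rowP => j; rewrite !mxE liftK.
Qed.

Lemma uncons_rVK d : cancel (@uncons_rV d) (@cons_rV d).
Proof.
move=> x; apply/rowP => j; rewrite mxE.
by case: (unliftP ord0 j) => [k|] -> /=; rewrite ?mxE.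
Qed.

Lemma measurable_uncons_rV d : measurable_fun setT (@uncons_rV d).
Proof.
apply: measurable_fun_pair; first exact: measurable_coord.
apply: measurable_fun_rV => j; under eq_fun do rewrite mxE.
exact: measurable_coord.
Qed.

Section step.
Variables (d : nat) (mu : {sigma_finite_measure set 'rV[R]_d -> \bar R}).

Definition lebesgue_cons : set 'rV[R]_d.+1 -> \bar R :=
  pushforward (lebesgue_measure \x mu)%E (@cons_rV d).


Let pmu : {measure set 'rV[R]_d.+1 -> \bar R} :=
  measure_function_pushforward__canonical__measure_function_Measure
    (lebesgue_measure \x mu)%E (@measurable_cons_rV d).

HB.instance Definition _ := Measure.copy lebesgue_cons pmu.

Let sigma_finite_lebesgue_cons : sigma_finite setT lebesgue_cons.
Proof.
have [F TF Foo] := sigma_finite_product (@lebesgue_measure R) mu.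
exists (fun n => @uncons_rV d @^-1` F n) => [|n].
  by rewrite -preimage_bigcup -TF preimage_setT.
have [mF Fn] := Foo n; split.
  by rewrite -[X in measurable X]setTI; exact: measurable_uncons_rV.
rewrite /lebesgue_cons /pushforward -comp_preimage.
by rewrite (_ : _ \o _ = id)//; apply/funext => p /=; rewrite cons_rVK.
Qed.

HB.instance Definition _ := Measure_isSigmaFinite.Build _ _ _ lebesgue_cons
  sigma_finite_lebesgue_cons.

End step.

(* Product of d copies of the Lebesgue measure of R, along the identification
   cons_rV of R x R^d with R^(d+1); R^0 is a point of mass 1. It is a measure
   on the Borel sets, like the library's lebesgue_measure on R. *)
Fixpoint lebesgue_rV d : {sigma_finite_measure set 'rV[R]_d -> \bar R} :=
  match d with
  | 0%N => \d_ (0 : 'rV[R]_0)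
  | d'.+1 => lebesgue_cons (lebesgue_rV d')
  end.

Lemma lebesgue_rV_box d (A : 'I_d -> set R) :
  (forall i, measurable (A i)) ->
  lebesgue_rV d [set x | forall i, A i (x ord0 i)] =
  (\prod_i lebesgue_measure (A i))%E.
Proof.
elim: d A => [|d IH] A mA.
  rewrite big_ord0 /= diracE mem_set//=; by case.
rewrite big_ord_recl -IH//.
rewrite [LHS]/= /lebesgue_cons /pushforward -product_measure1E//; first last.
- exact: (@measurable_box _ _ (fun i => A (lift ord0 i))).
- exact: mA.
congr (product_measure1 _ _ _); apply/seteqP; split=> -[a y] /=.
  move=> h; split=> [|j].
    by have := h ord0; rewrite mxE unlift_none.
  by have := h (lift ord0 j); rewrite mxE liftK.
move=> [Aa Ay] j; rewrite mxE.
by case: (unliftP ord0 j) => [k|] ->.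
Qed.
End lebesgue_rV.

Section vector_fields.
Variables (R : realType) (d : nat).
Implicit Types (A : 'rV[R]_d -> R -> 'rV[R]_d) (T t : R) (x : 'rV[R]_d).

(* l is the derivative at t of the restriction of f to I: it is one-sided at
   an end point of an interval I. *)
Definition is_derive_within (V : normedModType R) (I : set R) (f : R -> V)
    (t : R) (l : V) :=
  (fun u => (u - t)^-1 *: (f u - f t)) @ within I t^' --> l.

Definition slab T : set ('rV[R]_d * R) := [set p | 0 <= p.2 <= T].

Definition partial_x A (j : 'I_d) x t : 'rV[R]_d :=
  'D_(delta_mx ord0 j) (A ^~ t) x.

(* At is the partial derivative in time, one-sided at 0 and at T. *)
Definition C1_field T A :=
  [/\ {within slab T, continuous (fun p => A p.1 p.2)},
      forall j, (forall x t, 0 <= t <= T ->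
                   derivable (A ^~ t) x (delta_mx ord0 j)) /\
                {within slab T, continuous (fun p => partial_x A j p.1 p.2)}
    & exists At : 'rV[R]_d -> R -> 'rV[R]_d,
        (forall x t, 0 <= t <= T ->
           is_derive_within `[0, T] (A x) t (At x t)) /\
        {within slab T, continuous (fun p => At p.1 p.2)}].

(* The library's 'J is the matrix of the differential, which is unspecified
   where the map is not known to be differentiable; this is the matrix of the
   partial derivatives, in the convention acting on column vectors. *)
Definition jacobian_x A x t : 'M[R]_d :=
  \matrix_(i, j) partial_x A j x t ord0 i.

(* The library norm on matrices is the maximum norm. *)
Definition enorm (v : 'cV[R]_d) : R := Num.sqrt (\sum_i v i ord0 ^+ 2).

Definition opnorm (M : 'M[R]_d) : R :=
  sup [set enorm (M *m v) | v in [set v | enorm v <= 1]].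

Definition ode_solution T A (t1 : R) x (s : R -> 'rV[R]_d) :=
  s t1 = x /\
  forall t, 0 <= t <= T -> is_derive_within `[0, T] s t (A (s t) t).

(* The flow map from time t1 to time t2, both in [0, T]. The default value
   of xget is irrelevant: for the fields considered, the solution exists and
   is unique on [0, T]. *)
Definition flow T A (t1 t2 : R) x : 'rV[R]_d :=
  xget (fun=> x) (ode_solution T A t1 x) t2.

Definition moving_domain T A (Omega : set 'rV[R]_d) t : set 'rV[R]_d :=
  flow T A T t @` Omega.

Definition test_function T A (Psi : 'rV[R]_d -> R) x t : R :=
  Psi (flow T A t T x).

End vector_fields.

Section function_spaces.
Variables (R : realType) (d : nat).
Local Notation mu := (lebesgue_rV R d).
Implicit Types (G Omega : set 'rV[R]_d) (f Psi : 'rV[R]_d -> R).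

(* f \_ G is f extended by zero outside G. Elements of L^2 are represented by
   Borel functions; every Lebesgue class has such a representative. *)
Definition L2 G f : Prop := f \_ G \in Lfun mu 2%:E.

(* the complement of the largest open set on which f vanishes a.e. *)
Definition ess_support f : set 'rV[R]_d :=
  [set x | forall V, nbhs x V -> ~ (f = (fun=> 0) %[ae mu in V])].

Definition H0 Omega Psi :=
  [/\ L2 setT Psi, compact (ess_support Psi) & ess_support Psi `<=` Omega].

(* The time integrability is with respect to Lebesgue measurable functions
   on [0, T], whence the completed measure. *)
Definition L1_L2 (T : R) (G : R -> set 'rV[R]_d) (U : 'rV[R]_d -> R -> R) :=
  (forall t, 0 <= t <= T -> L2 (G t) (U ^~ t)) /\
  (@completed_lebesgue_measure R).-integrable `[0, T]
    (fun t : R => 'N[mu]_2%:E[EFin \o ((U ^~ t) \_ (G t))]%E).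

Definition is_solution (T : R) (A : 'rV[R]_d -> R -> 'rV[R]_d) Omega
    (U0 : 'rV[R]_d -> R) (U : 'rV[R]_d -> R -> R) :=
  let Omt := moving_domain T A Omega in
  [/\ L1_L2 T Omt U,
      (U ^~ 0) = U0 %[ae mu in Omt 0]
    & forall Psi, H0 Omega Psi -> forall t, 0 <= t <= T ->
        is_derive_within `[0, T]
          (fun s => \int[mu]_(x in Omt s) (U x s * test_function T A Psi x s)
             : R^o) t 0].

End function_spaces.

(* Main.v *)
Require Import Defs.
From mathcomp Require Import all_boot all_order all_algebra.
From mathcomp Require Import all_classical all_reals all_analysis.
From mathcomp Require Import measurable_realfun ring lra.

(* If U and V are solutions with the same data, then U(., t) and V(., t) have
   the same integral against every test function psi(., t): both integrals are
   constant in time and agree at time 0. The flow from T to t is a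
   homeomorphism with inverse the flow from t to T, so every Borel subset Q of
   the moving domain whose transport to time T lies in a compact subset of
   Omega is of the form 1_Q = psi(., t), where Psi is the indicator of the
   transport of Q. Testing with Q inside {U(., t) > V(., t)} shows that this
   set is negligible. The properties of the flow come from the Picard
   iteration: the bound on the Jacobian matrix makes the field globally
   Lipschitz in space. *)

Set Implicit Arguments.
Unset Strict Implicit.
Unset Printing Implicit Defensive.

Import Order.TTheory GRing.Theory Num.Theory numFieldNormedType.Exports.

Local Open Scope classical_set_scope.
Local Open Scope ring_scope.

(** * One-variable calculus on [0, T]: one-sided derivatives, comparison, primitives *)

Section derivatives_on_a_segment.
Variable R : realType.
Implicit Types (f g df dg : R -> R) (a b T t : R).

(** Near [t] the difference quotient is within 1 of [l], so [f u - f t] is at most [|l| + 1] times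
    [|u - t|] in norm. *)
Lemma is_derive_within_continuous (V : normedModType R) (I : set R)
    (f : R -> V) (t : R) (l : V) :
  is_derive_within I f t l -> f u @[u --> within I (nbhs t)] --> f t.
Proof.
move=> fl; apply/cvgrPdist_lt => e e0.
have := fl; move/cvgrPdist_le => /(_ 1 ltr01); rewrite !near_withinE => H.
have l0 : 0 < `|l| + 1 by rewrite ltr_pwDr.
have H2 : \forall u \near t, `|t - u| < e / (`|l| + 1).
  by apply: nbhsx_ballx; exact: divr_gt0.
near=> u => Iu; have [->|ut] := eqVneq u t; first by rewrite subrr normr0.
have ut0 : u - t != 0 by rewrite subr_eq0.
have Hq : `|l - (u - t)^-1 *: (f u - f t)| <= 1.
  by move: ut Iu; near: u.
have {}Hq : `|(u - t)^-1 *: (f u - f t)| <= `|l| + 1.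
  rewrite -lerBlDl (le_trans _ Hq)// distrC.
  by rewrite (le_trans (lerB_dist _ _))// .
move: Hq; rewrite normrZ normfV ler_pdivrMl ?normr_gt0// => Hq.
rewrite distrC (le_lt_trans Hq)// -ltr_pdivlMr// distrC.
by near: u.
Unshelve. all: by end_near.
Qed.

(** Near an interior point the restriction to the segment is void; what remains is the change of
    variable [u = h + t]. *)
Lemma is_derive_within_interior a b f (l t : R) : t \in `]a, b[ ->
  is_derive_within `[a, b] (f : R -> R^o) t l -> is_derive t 1 f l.
Proof.
move=> tab fl; have H : h^-1 *: ((f \o shift t) (h *: 1) - f t) @[h --> 0^'] --> l.
  apply/cvgrPdist_lt => e e0; move/cvgrPdist_lt : fl => /(_ e e0).
  rewrite !near_withinE => H.
  have {}H : \forall u \near t, u != t -> `|l - (u - t)^-1 *: (f u - f t)| < e.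
    have : \forall u \near t, u \in `]a, b[ by exact: near_in_itvoo.
    apply: filterS2 H => u /[swap] uab /[swap] ut /(_ ut); apply.
    exact: subset_itv_oo_cc uab.
  move: H; rewrite (@near_shift _ R 0 t) subr0.
  apply: filterS => h /=; rewrite addrK scaler1 => H h0; apply: H.
  by rewrite -subr_eq0 addrK.
split; first by apply/cvg_ex; exists l.
exact: (cvg_lim _ H).
Qed.

Lemma is_derive_is_derive_within (V : normedModType R) (I : set R) (f : R -> V)
    (t : R) (l : V) : is_derive t 1 f l -> is_derive_within I f t l.
Proof.
move=> [dfl lE]; apply/cvgrPdist_lt => e e0.
have H : h^-1 *: ((f \o shift t) (h *: 1) - f t) @[h --> 0^'] --> l.
  by rewrite -lE; exact: dfl.
move/cvgrPdist_lt : H => /(_ e e0); rewrite !near_withinE => H.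
have {}H : \forall h \near (0 : R), h != 0 ->
    `|l - h^-1 *: (f (h + t) - f t)| < e.
  by apply: filterS H => h /[apply]; rewrite /= [h *: 1]mulr1.
move: H; rewrite (@near_shift _ R t 0) sub0r.
apply: filterS => u /=; rewrite subrK => H ut _; apply: H.
by rewrite subr_eq0.
Qed.

(* Differentiability is only required inside the segment: the mean value
   theorem needs no more. *)
Definition has_derivative_on T f df :=
  {within `[0, T], continuous f} /\
  forall t, t \in `]0, T[ -> is_derive t 1 f (df t).

Lemma has_derivative_on_within T f df :
  (forall t, 0 <= t <= T -> is_derive_within `[0, T] (f : R -> R^o) t (df t)) ->
  has_derivative_on T f df.
Proof.
move=> H; split.
  apply/subspace_continuousP => t /=; rewrite in_itv/= => /H.
  exact: is_derive_within_continuous.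
move=> t tT; apply: (is_derive_within_interior tT); apply: H.
by move: tT; rewrite in_itv/= => /andP[/ltW -> /ltW ->].
Qed.

Lemma has_derivative_on_is_derive T f df :
  (forall t, 0 <= t <= T -> is_derive t 1 f (df t)) -> has_derivative_on T f df.
Proof.
move=> H; apply: has_derivative_on_within => t /H.
exact: is_derive_is_derive_within.
Qed.

Lemma has_derivative_onB T f df g dg : has_derivative_on T f df ->
  has_derivative_on T g dg -> has_derivative_on T (f \- g) (df \- dg).
Proof.
move=> [cf Hf] [cg Hg]; split=> [|t tT].
  by move=> x; apply: continuousB; [exact: cf|exact: cg].
by have ? := Hf t tT; have ? := Hg t tT; apply: is_deriveB.
Qed.

Lemma has_derivative_onD T f df g dg : has_derivative_on T f df ->
  has_derivative_on T g dg -> has_derivative_on T (f \+ g) (df \+ dg).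
Proof.
move=> [cf Hf] [cg Hg]; split=> [|t tT].
  by move=> x; apply: continuousD; [exact: cf|exact: cg].
by have ? := Hf t tT; have ? := Hg t tT; apply: is_deriveD.
Qed.

Lemma has_derivative_on_homo T f df : has_derivative_on T f df ->
  (forall t, t \in `]0, T[ -> 0 <= df t) ->
  forall u v, 0 <= u -> u <= v -> v <= T -> f u <= f v.
Proof.
move=> [cf df'] df0 u v u0 uv vT.
apply: (@ger0_derive1_le_cc _ f 0 T) => //.
- by move=> t /df'[].
- by move=> t tT; rewrite derive1E (@derive_val _ _ _ _ _ _ _ (df' _ tT)) df0.
- by rewrite in_itv/= u0 (le_trans uv vT).
- by rewrite in_itv/= vT (le_trans u0 uv).
Qed.

(** Both [g + f] and [g - f] are nondecreasing, since [|df| <= dg]. This takes the place of bounding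
    an integral by the integral of the norm. *)
Lemma has_derivative_on_dominated T f df g dg :
  has_derivative_on T f df -> has_derivative_on T g dg ->
  (forall t, t \in `]0, T[ -> `|df t| <= dg t) ->
  forall s t, 0 <= s <= T -> 0 <= t <= T -> `|f t - f s| <= `|g t - g s|.
Proof.
move=> Hf Hg le_df.
have incD := has_derivative_on_homo (has_derivative_onD Hg Hf).
have incB := has_derivative_on_homo (has_derivative_onB Hg Hf).
have {}incD : forall u v, 0 <= u -> u <= v -> v <= T -> (g \+ f) u <= (g \+ f) v.
  by apply: incD => t /le_df /=; rewrite ler_norml => /andP[]; lra.
have {}incB : forall u v, 0 <= u -> u <= v -> v <= T -> (g \- f) u <= (g \- f) v.
  by apply: incB => t /le_df /=; rewrite ler_norml => /andP[]; lra.
have H u v : 0 <= u -> u <= v -> v <= T -> `|f v - f u| <= `|g v - g u|.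
  move=> u0 uv vT; have := incD _ _ u0 uv vT; have := incB _ _ u0 uv vT => /=.
  move=> h1 h2; rewrite (ger0_norm (_ : 0 <= g v - g u)); last by lra.
  by rewrite ler_norml; apply/andP; split; lra.
move=> s t /andP[s0 sT] /andP[t0 tT]; have [st|/ltW ts] := leP s t; first exact: H.
by rewrite distrC [leRHS]distrC; exact: H.
Qed.

Lemma has_derivative_on_cst T f : has_derivative_on T f (cst 0) ->
  forall s t, 0 <= s <= T -> 0 <= t <= T -> f t = f s.
Proof.
move=> Hf s t sT tT; apply/eqP; rewrite -subr_eq0 -normr_le0.
have H0 : has_derivative_on T (cst 0) (cst 0).
  by apply: has_derivative_on_is_derive => ? _; exact: is_derive_cst.
have := has_derivative_on_dominated Hf H0 _ sT tT.
by rewrite /= subrr normr0; apply.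
Qed.

Lemma has_derivative_on_bounded T f df : 0 <= T -> has_derivative_on T f df ->
  exists C, forall t, 0 <= t <= T -> `|f t| <= C.
Proof.
move=> T0 [cf _].
have cn : {within `[0, T], continuous (fun t => `|f t|)}.
  by move=> x; apply: (continuous_comp (cf x)); exact: norm_continuous.
have [c _ H] := EVT_max T0 cn.
by exists `|f c| => t tT; apply: H; rewrite in_itv.
Qed.

Lemma continuous_primitive T f : continuous f ->
  exists F, forall t, 0 <= t <= T -> is_derive t 1 F (f t).
Proof.
(* Integrating from -1, and up to [T + 1] below, makes 0 and [T] interior points, so the derivative
   is two-sided there too. *)
move=> cf; exists (fun x => \int[lebesgue_measure]_(u in `[- 1, x]) f u).
move=> t /andP[t0 tT].
have fi : lebesgue_measure.-integrable `[- 1, T + 1] (EFin \o f).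
  apply: continuous_compact_integrable; first exact: segment_compact.
  exact: continuous_subspaceT.
have tT1 : t < T + 1 by rewrite ltr_pwDr.
have t1 : -1 < t by rewrite (lt_le_trans _ t0)// ltrN10.
have [dF Ft] := @continuous_FTC1_closed _ f (- 1) t (T + 1) tT1 fi t1 (cf t).
by apply: DeriveDef; [exact: dF|rewrite -derive1E; exact: Ft].
Qed.

End derivatives_on_a_segment.

(** * The maximum norm and coordinates *)

Section rV_norm.
Variables (R : realType) (d : nat).
Implicit Types (x : 'rV[R]_d) (C : R).

Lemma le_coord_norm x j : `|x ord0 j| <= `|x|.
Proof.
rewrite [leRHS]/Num.norm/= mx_normrE.
exact: (le_bigmax _ (fun i : 'I_1 * 'I_d => `|x i.1 i.2|) (ord0, j)).
Qed.

Lemma rV_norm_le x C : 0 <= C -> (forall j, `|x ord0 j| <= C) -> `|x| <= C.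
Proof.
move=> C0 H; rewrite /Num.norm/= mx_normrE.
by apply: bigmax_le => // -[i j] _ /=; rewrite ord1.
Qed.

End rV_norm.

(** * An exponential weight for the Picard iteration *)

Section growth_weight.
Variables (R : realType) (k : R) (k_gt0 : 0 < k).
Implicit Types (s t : R).

(** This is 2 cosh(k(t - s)), a smooth substitute for exp(k|t - s|) that grows on both sides of
    [s]. *)
Definition weight s t := expR (k * (t - s)) + expR (- (k * (t - s))).

(** This is (2/k) sinh(k(t - s)), the primitive of the weight that vanishes at [s]. *)
Definition weight_primitive s t :=
  k^-1 * (expR (k * (t - s)) - expR (- (k * (t - s)))).

Lemma weight_ge1 s t : 1 <= weight s t.
Proof.
rewrite /weight; have := expR_gt0 (k * (t - s)); have := expR_gt0 (- (k * (t - s))).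
have [h|/ltW h] := leP 0 (k * (t - s)).
  have : 1 <= expR (k * (t - s)) by rewrite -expR0 ler_expR.
  lra.
have : 1 <= expR (- (k * (t - s))) by rewrite -expR0 ler_expR oppr_ge0.
lra.
Qed.

Lemma is_derive_weight_primitive s t :
  is_derive t 1 (weight_primitive s) (weight s t).
Proof.
rewrite /weight_primitive /weight.
have H : is_derive t 1 (fun u : R => k * (u - s)) k.
  by apply: is_derive_eq; rewrite subr0 [LHS]mulr1.
have HN : is_derive t 1 (fun u : R => - (k * (u - s))) (- k) by exact: is_deriveN.
have E := is_derive1_comp (is_derive_expR _) H.
have EN := is_derive1_comp (is_derive_expR _) HN.
apply: is_derive_eq (is_deriveZ k^-1 (is_deriveB E EN)) _.
rewrite mulrN opprK -mulrDl -[LHS]/(_ * _) mulrC mulfK//.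
exact: lt0r_neq0.
Qed.

(** As |sinh| <= cosh, integrating the weight gains a factor [k^-1], which is the source of the
    contraction. *)
Lemma weight_primitive_le s t : `|weight_primitive s t| <= k^-1 * weight s t.
Proof.
rewrite normrM ger0_norm ?invr_ge0 ?(ltW k_gt0)// ler_wpM2l ?invr_ge0 ?(ltW k_gt0)//.
by rewrite (le_trans (ler_normB _ _))// !ger0_norm ?expR_ge0.
Qed.

Lemma weight_primitivess s : weight_primitive s s = 0.
Proof. by rewrite /weight_primitive subrr mulr0 oppr0 subrr mulr0. Qed.

End growth_weight.

(** * Contraction and stability for Lipschitz fields *)

Section lipschitz_ode.
Variables (R : realType) (d : nat) (T L : R) (T_ge0 : 0 <= T) (L_gt0 : 0 < L).
Variable A : 'rV[R]_d -> R -> 'rV[R]_d.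
Hypothesis A_lip : forall t, 0 <= t <= T ->
  forall x y, `|A x t - A y t| <= L * `|x - y|.
Implicit Types (s v z : R -> 'rV[R]_d) (C D t : R).

Definition trajectory s v := forall j,
  has_derivative_on T (fun t => s t ord0 j) (fun t => v t ord0 j).

Local Notation w := (weight (2 * L)).

(* The weight turns the Picard map into a contraction of factor 1/2 on the
   whole of [0, T], on both sides of t1. *)
Lemma picard_contraction s1 s2 z1 z2 t1 C D : 0 <= C -> 0 <= D ->
  trajectory s1 (fun t => A (z1 t) t) -> trajectory s2 (fun t => A (z2 t) t) ->
  0 <= t1 <= T -> `|s1 t1 - s2 t1| <= D ->
  (forall t, 0 <= t <= T -> `|z1 t - z2 t| <= C * w t1 t) ->
  forall t, 0 <= t <= T -> `|s1 t - s2 t| <= (D + C / 2) * w t1 t.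
Proof.
move=> C0 D0 Hs1 Hs2 t1T sD zC t tT.
have L2 : 0 < 2 * L by rewrite mulr_gt0.
have w1 := weight_ge1 (2 * L) t1 t.
apply: rV_norm_le => [|j]; first by rewrite mulr_ge0//; lra.
(* Comparison function: its derivative [L * C * w] dominates the difference of the velocities, and
   it is itself at most [L * C * (2 * L)^-1 * w = C / 2 * w]. *)
have HW : has_derivative_on T (fun t => L * C * weight_primitive (2 * L) t1 t)
    (fun t => L * C * w t1 t).
  apply: has_derivative_on_is_derive => u _.
  have H := is_derive_weight_primitive L2 t1 u.
  exact: (is_deriveZ (L * C) H).
have := has_derivative_on_dominated (has_derivative_onB (Hs1 j) (Hs2 j)) HW _ t1T tT.
rewrite weight_primitivess mulr0 subr0 /= !mxE => H.
have {}H : `|s1 t ord0 j - s2 t ord0 j - (s1 t1 ord0 j - s2 t1 ord0 j)|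
    <= C / 2 * w t1 t.
  apply: le_trans (H _) _ => [u uT|].
    have {}uT : 0 <= u <= T by move: uT; rewrite in_itv/= => /andP[/ltW-> /ltW->].
    have := le_coord_norm (A (z1 u) u - A (z2 u) u) j; rewrite !mxE => /le_trans.
    apply; rewrite -mulrA (le_trans (A_lip uT _ _))// ler_wpM2l ?zC//.
    exact: ltW.
  rewrite normrM ger0_norm ?mulr_ge0// ?(ltW L_gt0)//.
  apply: le_trans (ler_wpM2l _ (weight_primitive_le L2 t1 t)) _.
    by rewrite mulr_ge0// ltW.
  rewrite le_eqVlt; apply/orP; left; apply/eqP; field; exact: lt0r_neq0.
have H1 : `|s1 t1 ord0 j - s2 t1 ord0 j| <= D.
  by apply: le_trans sD; have := le_coord_norm (s1 t1 - s2 t1) j; rewrite !mxE.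
have -> : s1 t ord0 j - s2 t ord0 j =
  (s1 t ord0 j - s2 t ord0 j - (s1 t1 ord0 j - s2 t1 ord0 j)) +
  (s1 t1 ord0 j - s2 t1 ord0 j) by ring.
apply: le_trans (ler_normD _ _) _; rewrite mulrDl addrC lerD//.
by apply: le_trans H1 _; rewrite ler_peMr.
Qed.

Lemma trajectory_bounded s v : trajectory s v ->
  exists2 C, 0 <= C & forall t, 0 <= t <= T -> `|s t| <= C.
Proof.
move=> Hs; have /choice[C HC] j := has_derivative_on_bounded T_ge0 (Hs j).
exists (\sum_j `|C j|) => [|t tT]; first exact: sumr_ge0.
apply: rV_norm_le => [|j]; first exact: sumr_ge0.
rewrite (bigD1 j)//= (le_trans (HC j t tT))// (le_trans (ler_norm _))//.
by rewrite lerDl sumr_ge0.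
Qed.

(** Each solution is its own Picard image, so a bound [C * w] on the distance improves to
    [(D + C / 2) * w]. Iterating from a crude bound leads to the fixed point [2 * D]. *)
Lemma trajectory_stable s1 s2 t1 D : 0 <= D ->
  trajectory s1 (fun t => A (s1 t) t) -> trajectory s2 (fun t => A (s2 t) t) ->
  0 <= t1 <= T -> `|s1 t1 - s2 t1| <= D ->
  forall t, 0 <= t <= T -> `|s1 t - s2 t| <= 2 * D * w t1 t.
Proof.
move=> D0 Hs1 Hs2 t1T sD t tT.
have [C1 C10 HC1] := trajectory_bounded Hs1.
have [C2 C20 HC2] := trajectory_bounded Hs2.
have H n : forall t, 0 <= t <= T ->
    `|s1 t - s2 t| <= (2 * D + (C1 + C2) / 2 ^+ n) * w t1 t.
  elim: n => [|n IH] u uT.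
    rewrite expr0 divr1; have w1 := weight_ge1 (2 * L) t1 u.
    apply: le_trans (ler_normB _ _) _.
    apply: le_trans (lerD (HC1 u uT) (HC2 u uT)) _.
    by rewrite (le_trans (_ : _ <= 2 * D + (C1 + C2)))// ?ler_peMr//; lra.
  have -> : 2 * D + (C1 + C2) / 2 ^+ n.+1 = D + (2 * D + (C1 + C2) / 2 ^+ n) / 2.
    by rewrite exprS invfM; field.
  apply: picard_contraction IH _ uT => //.
  by rewrite addr_ge0// ?mulr_ge0// ?divr_ge0 ?addr_ge0// ?exprn_ge0.
have w0 : 0 < w t1 t by exact: lt_le_trans (weight_ge1 _ _ _).
rewrite -ler_pdivrMr//.
have cv : (2 * D + (C1 + C2) / 2 ^+ n) @[n --> \oo] --> 2 * D + (C1 + C2) * 0.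
  apply: cvgD; first exact: cvg_cst.
  apply: cvgMr; under eq_fun do rewrite -exprVn.
  by apply: cvg_expr; rewrite ger0_norm// invf_lt1// ltr1n.
have -> : 2 * D = 2 * D + (C1 + C2) * 0 by rewrite mulr0 addr0.
apply: (ler_cvg_to (cvg_cst _) cv); apply: nearW => n.
by rewrite ler_pdivrMr// H.
Qed.

End lipschitz_ode.

(** * Geometric bounds *)

Section geometric.
Variable R : realType.

Lemma geometric_small (K e : R) : 0 < e -> exists n, K / 2 ^+ n < e.
Proof.
move=> e0; have cv : (K / 2 ^+ n) @[n --> \oo] --> K * 0.
  apply: cvgMr; under eq_fun do rewrite -exprVn.
  by apply: cvg_expr; rewrite ger0_norm// invf_lt1// ltr1n.
rewrite mulr0 in cv; move/cvgrPdist_lt : cv => /(_ e e0)[n _ /(_ n (leqnn n))].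
rewrite /= sub0r normrN => H; exists n; exact: le_lt_trans (ler_norm _) H.
Qed.

Lemma le0_geometric (K y : R) : (forall n, y <= K / 2 ^+ n) -> y <= 0.
Proof.
move=> H; rewrite leNgt; apply/negP => /(geometric_small K)[n].
by rewrite ltNge H.
Qed.

End geometric.

(** * Projection of the time line onto [0, T] *)

Section clamp.
Variables (R : realType) (T : R) (T_ge0 : 0 <= T).

(** Composition with this projection extends a curve on [0, T] to the whole line, so that continuity
    and primitives can be taken on [R]. *)
Definition clamp (t : R) : R := Num.max 0 (Num.min T t).

Lemma clamp_itv t : 0 <= clamp t <= T.
Proof. by rewrite /clamp le_max lexx /= ge_max T_ge0 ge_min lexx. Qed.

Lemma clamp_id t : 0 <= t <= T -> clamp t = t.
Proof. by move=> /andP[t0 tT]; rewrite /clamp min_r// max_r. Qed.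

Lemma continuous_clamp : continuous clamp.
Proof.
move=> t; apply: (@continuous_max _ _ (cst 0) (fun t => Num.min T t)).
  exact: cvg_cst.
by apply: (@continuous_min _ _ (cst T) id); [exact: cvg_cst|exact: cvg_id].
Qed.

End clamp.

(** * Existence of solutions on the whole of [0, T] *)

Section picard_lindelof.
Variables (R : realType) (d : nat) (T L : R) (T_ge0 : 0 <= T) (L_gt0 : 0 < L).
Variable A : 'rV[R]_d -> R -> 'rV[R]_d.
Hypothesis A_lip : forall t, 0 <= t <= T ->
  forall x y, `|A x t - A y t| <= L * `|x - y|.
Hypothesis A_cont : {within slab T, continuous (fun p => A p.1 p.2)}.
Implicit Types (s z : R -> 'rV[R]_d) (t : R).
Local Notation w := (weight (2 * L)).
Local Notation c := (clamp T).

(** The field is continuous only within the slab; clamping the time keeps the curve [p] inside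
    it. *)
Lemma continuous_field_along z : continuous (z \o c) ->
  continuous (fun t => A (z (c t)) (c t)).
Proof.
move=> cz t; pose p u := (z (c u), c u).
have pslab u : slab T (p u) by exact: clamp_itv.
have cp : p u @[u --> t] --> within (slab T) (nbhs (p t)).
  have cp : p u @[u --> t] --> p t.
    exact: cvg_pair (cz t) (@continuous_clamp _ T t).
  move=> P HP; have H : \forall u \near t, slab T (p u) -> P (p u) := cp _ HP.
  by apply: filterS H => u /(_ (pslab u)).
move/subspace_continuousP : A_cont => /(_ _ (pslab t)).
exact: cvg_comp cp.
Qed.

(** One Picard step: each coordinate of the clamped field is continuous on [R] and has a primitive,
    normalised to match [x] at [t1]. *)
Lemma picard_step t1 (x : 'rV[R]_d) z : 0 <= t1 <= T -> continuous (z \o c) ->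
  exists s, [/\ s t1 = x, continuous (s \o c) &
    forall t, 0 <= t <= T ->
      forall j, is_derive t 1 (fun t => s t ord0 j) (A (z t) t ord0 j)].
Proof.
move=> t1T /continuous_field_along cf.
have /choice[F HF] (j : 'I_d) : exists F : R -> R, forall t, 0 <= t <= T ->
    is_derive t 1 F (A (z (c t)) (c t) ord0 j).
  apply: continuous_primitive => t.
  exact: (continuous_comp (cf t) (@coord_continuous _ _ _ _ _ _)).
pose s t := \row_j (x ord0 j - F j t1 + F j t).
have ds t : 0 <= t <= T ->
    forall j, is_derive t 1 (fun t => s t ord0 j) (A (z t) t ord0 j).
  move=> tT j; have := HF j t tT; rewrite (clamp_id tT) => H.
  have -> : (fun t => s t ord0 j) = (fun t => x ord0 j - F j t1 + F j t).
    by apply/funext => u; rewrite mxE.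
  by have := is_deriveD (is_derive_cst (x ord0 j - F j t1) t 1) H; rewrite add0r.
exists s; split => //.
  by apply/rowP => j; rewrite mxE subrK.
move=> t; apply: (continuous_comp (@continuous_clamp _ T t)).
apply: differentiable_continuous; apply/derivable1_diffP/derivable_mxP => i j.
by rewrite (ord1 i); have [] := ds _ (clamp_itv T_ge0 t) j.
Qed.

Lemma picard_lindelof t1 (x : 'rV[R]_d) : 0 <= t1 <= T ->
  exists s, s t1 = x /\ forall t, 0 <= t <= T ->
    forall j, is_derive t 1 (fun t => s t ord0 j) (A (s t) t ord0 j).
Proof.
move=> t1T.
(* The Picard map as a total function; its specification is void on curves whose clamped version is
   not continuous. *)
have /choice[N HN] z : exists s, continuous (z \o c) -> [/\ s t1 = x,
    continuous (s \o c) & forall t, 0 <= t <= T ->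
      forall j, is_derive t 1 (fun t => s t ord0 j) (A (z t) t ord0 j)].
  have [cz|ncz] := pselect (continuous (z \o c)).
    by have [s ?] := picard_step x t1T cz; exists s.
  by exists z.
have trajN z : continuous (z \o c) -> trajectory T (N z) (fun t => A (z t) t).
  by move=> /HN[_ _ H] j; apply: has_derivative_on_is_derive => t /H.
pose S n := iter n N (cst x).
have cS n : continuous (S n \o c).
  by elim: n => [|n /HN[]//]; move=> t; exact: cvg_cst.
have St1 n : S n t1 = x by case: n => // n; have [] := HN _ (cS n).
have [C C0 HC] : exists2 C, 0 <= C &
    forall t, 0 <= t <= T -> `|S 1%N t - S 0%N t| <= C * w t1 t.
  have [C C0 HC] := trajectory_bounded T_ge0 (trajN _ (cS 0%N)).
  exists (C + `|x|) => [|t tT]; first exact: addr_ge0.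
  apply: le_trans (ler_normB _ _) _.
  apply: (@le_trans _ _ (C + `|x|)); first by rewrite lerD2r HC.
  by rewrite ler_peMr ?addr_ge0// weight_ge1.
have SS n t : 0 <= t <= T -> `|S n.+1 t - S n t| <= C / 2 ^+ n * w t1 t.
  elim: n t => [|n IH] t tT; first by rewrite expr0 divr1 HC.
  rewrite exprSr invfM mulrA -[X in X * w _ _]add0r.
  have H0 : `|S n.+2 t1 - S n.+1 t1| <= 0 by rewrite !St1 subrr normr0.
  apply: (picard_contraction L_gt0 A_lip _ _ (trajN _ (cS n.+1))
    (trajN _ (cS n)) t1T H0 IH tT) => //.
  by rewrite divr_ge0// exprn_ge0.
(* [M] bounds the weight on [0, T], and [K / 2 ^+ n] is the sum of the tail of the series of terms
   [C * M / 2 ^+ k] from [k = n] on. *)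
pose M := 2 * expR (2 * L * T); pose K := 2 * C * M.
have wM t : 0 <= t <= T -> w t1 t <= M.
  move=> /andP[t0 tT]; have /andP[t10 t1T'] := t1T.
  have L0 := ltW L_gt0; have L2 : 0 <= 2 * L by rewrite mulr_ge0.
  rewrite /weight /M [leRHS]mulr_natl mulr2n lerD// ler_expR ?ler_wpM2l//; first lra.
  by rewrite -mulrN ler_wpM2l//; lra.
have M0 : 0 <= M by rewrite mulr_ge0// expR_ge0.
have K0 : 0 <= K by rewrite !mulr_ge0.
have p2 n : 0 <= (2 ^+ n)^-1 :> R by rewrite invr_ge0 exprn_ge0.
have Scauchy n m t : (n <= m)%N -> 0 <= t <= T -> `|S m t - S n t| <= K / 2 ^+ n.
  (* The subtracted term lets the induction close: passing from [m] to [m.+1] adds exactly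
     [C * M / 2 ^+ m] to the bound. *)
  move=> nm tT; have H : `|S m t - S n t| <= K / 2 ^+ n - K / 2 ^+ m.
    rewrite -(subnKC nm); elim: (m - n)%N => [|k IH].
      by rewrite addn0 !subrr normr0.
    rewrite addnS -(subrKA (S (n + k)%N t)) (le_trans (ler_normD _ _))//.
    have h : `|S (n + k).+1 t - S (n + k)%N t| <= C / 2 ^+ (n + k) * M.
      rewrite (le_trans (SS _ _ tT))// ler_wpM2l ?wM// mulr_ge0//.
    apply: le_trans (lerD h IH) _.
    rewrite exprSr invfM /K; have := p2 (n + k)%N; lra.
  by apply: le_trans H _; rewrite gerBl mulr_ge0.
pose s t := lim (S n t @[n --> \oo]).
have Scvg t : 0 <= t <= T -> S n t @[n --> \oo] --> s t.
  move=> tT; apply: (@cauchy_cvg 'rV[R]_d); apply: cauchy_exP => e e0.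
  have [n Hn] := geometric_small K e0; exists (S n t).
  exists n => // m /= nm; rewrite -ball_normE /= distrC.
  by rewrite (le_lt_trans (Scauchy _ _ _ nm tT)).
have sS n t : 0 <= t <= T -> `|s t - S n t| <= K / 2 ^+ n.
  move=> tT; have cv : `|S m t - S n t| @[m --> \oo] --> `|s t - S n t|.
    by apply: cvg_norm; exact: (cvgB (Scvg t tT) (cvg_cst (S n t))).
  have cK : K / 2 ^+ n @[_ --> \oo] --> K / 2 ^+ n by exact: cvg_cst.
  apply: (ler_cvg_to cv cK); exists n => // m /= nm.
  exact: Scauchy.
have cs : continuous (s \o c).
  move=> t; apply/cvgrPdist_lt => e e0.
  have e3 : 0 < e / 3 by rewrite divr_gt0.
  have [n Hn] := geometric_small K e3.
  have /cvgrPdist_lt/(_ _ e3) := cS n t; apply: filterS => u /= Hu.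
  have h1 := le_lt_trans (sS n _ (clamp_itv T_ge0 t)) Hn.
  have h2 := le_lt_trans (sS n _ (clamp_itv T_ge0 u)) Hn.
  have g1 := ler_distD (S n (c t)) (s (c t)) (s (c u)).
  have g2 := ler_distD (S n (c u)) (S n (c t)) (s (c u)).
  rewrite distrC in h2; move: h1 h2 Hu g1 g2 => /=; lra.
have [Ns1 _ dNs] := HN s cs.
(* Passage to the limit in [S n.+1 = N (S n)]: on [0, T] both [N s] and [s] are within a multiple of
   [1 / 2 ^+ n] of [S n.+1]. *)
have NsE t : 0 <= t <= T -> N s t = s t.
  move=> tT; apply/eqP; rewrite -subr_eq0 -normr_le0.
  apply: (@le0_geometric _ (K * (M + 1))) => n.
  have H0 : `|N s t1 - S n.+1 t1| <= 0 by rewrite St1 Ns1 subrr normr0.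
  have Hw u : 0 <= u <= T -> `|s u - S n u| <= K / 2 ^+ n * w t1 u.
    by move=> uT; rewrite (le_trans (sS n u uT))// ler_peMr ?weight_ge1// mulr_ge0.
  have := picard_contraction L_gt0 A_lip _ (lexx 0) (trajN _ cs) (trajN _ (cS n))
    t1T H0 Hw tT.
  rewrite add0r mulr_ge0// => /(_ isT) h1.
  have h2 := sS n.+1 t tT; rewrite distrC in h2.
  rewrite -(subrKA (S n.+1 t)) (le_trans (ler_normD _ _))//.
  apply: le_trans (lerD h1 h2) _.
  have q0 : 0 <= K / 2 ^+ n by rewrite mulr_ge0.
  have := ler_wpM2l q0 (wM t tT).
  have := mulr_ge0 q0 (le_trans ler01 (weight_ge1 (2 * L) t1 t)).
  rewrite exprSr invfM; nra.
(* The witness is [N s] and not [s]: the derivatives at 0 and [T] are two-sided, while [s] is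
   controlled on [0, T] only. *)
exists (N s); split => // t tT j; rewrite NsE//; exact: dNs.
Qed.

End picard_lindelof.

(** * Entries of a matrix and its operator norm *)

Section opnorm.
Variables (R : realType) (d : nat).
Implicit Types (M : 'M[R]_d) (v : 'cV[R]_d).

Lemma coord_le_enorm v i : `|v i ord0| <= enorm v.
Proof.
rewrite /enorm -sqrtr_sqr ler_wsqrtr// (bigD1 i)//= lerDl sumr_ge0// => *.
exact: sqr_ge0.
Qed.

Lemma enorm_delta j : enorm (delta_mx j ord0 : 'cV[R]_d) = 1.
Proof.
rewrite /enorm (bigD1 j)//= big1 ?mxE ?eqxx ?addr0 ?expr1n ?sqrtr1// => i ij.
by rewrite mxE (negbTE ij) expr0n.
Qed.

(** A crude bound, uniform in [v]: it shows that the set in [opnorm] is bounded above, so that its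
    [sup] dominates its elements. *)
Lemma enorm_mulmx_le M v : enorm v <= 1 ->
  enorm (M *m v) <= Num.sqrt (\sum_i (\sum_j `|M i j|) ^+ 2).
Proof.
move=> v1; rewrite ler_wsqrtr// ler_sum// => i _.
rewrite -real_normK ?num_real// lerXn2r ?nnegrE ?sumr_ge0//.
rewrite mxE (le_trans (ler_norm_sum _ _ _))// ler_sum// => j _.
by rewrite normrM ler_piMr// (le_trans (coord_le_enorm _ _)).
Qed.

Lemma coord_le_opnorm M i j : `|M i j| <= opnorm M.
Proof.
pose e := delta_mx j ord0 : 'cV[R]_d.
have -> : M i j = (M *m e) i ord0 by rewrite -colE mxE.
apply: le_trans (coord_le_enorm _ _) _; apply: ub_le_sup.
  exists (Num.sqrt (\sum_i (\sum_j `|M i j|) ^+ 2)) => _ [v /= v1 <-].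
  exact: enorm_mulmx_le.
by exists e => //=; rewrite enorm_delta.
Qed.

End opnorm.

(** * From bounded partial derivatives to a Lipschitz field *)

Section partials_lipschitz.
Variables (R : realType) (d : nat).

(** Mean value theorem on the line through [x] with direction [v]; a negative [h] is handled by
    exchanging the end points. *)
Lemma partial_bound_increment (g : 'rV[R]_d -> R) (v x : 'rV[R]_d) K h :
  (forall x, derivable g x v) -> (forall x, `|'D_v g x| <= K) ->
  `|g (x + h *: v) - g x| <= K * `|h|.
Proof.
move=> dg gK; wlog h0 : x h / 0 <= h => [H|].
  have [|/ltW h0] := leP 0 h; first exact: H.
  have := H (x + h *: v) (- h); rewrite oppr_ge0 h0 normrN => /(_ isT).
  by rewrite scaleNr addrK distrC.
have dphi (u : R) : is_derive u 1 (fun h => g (x + h *: v)) ('D_v g (x + u *: v)).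
  have E : (fun k : R => k^-1 *: (((fun h => g (x + h *: v)) \o shift u) (k *: 1)
      - g (x + u *: v))) =
    (fun k => k^-1 *: ((g \o shift (x + u *: v)) (k *: v) - g (x + u *: v))).
    apply/funext => k /=; rewrite [k *: 1]mulr1; congr (_ *: (g _ - _)).
    by rewrite scalerDl addrCA.
  by split; rewrite /derivable /derive E//; exact: dg.
have cphi : {within `[0, h], continuous (fun h => g (x + h *: v))}.
  by apply: derivable_within_continuous => u _; have [] := dphi u.
have [c _] := MVT_segment h0 (fun u _ => dphi u) cphi.
rewrite scale0r addr0 subr0 => ->.
by rewrite normrM ler_wpM2r.
Qed.

(* Change the coordinates of x into those of y one at a time. *)
Lemma partials_lipschitz (f : 'rV[R]_d -> 'rV[R]_d) K : 0 <= K ->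
  (forall j x, derivable f x (delta_mx ord0 j)) ->
  (forall i j x, `|('D_(delta_mx ord0 j) f x) ord0 i| <= K) ->
  forall x y, `|f x - f y| <= d%:R * K * `|x - y|.
Proof.
move=> K0 df fK x y.
apply: rV_norm_le => [|i]; first by rewrite !mulr_ge0.
rewrite !mxE distrC; pose g z := f z ord0 i.
have dg j z : derivable g z (delta_mx ord0 j).
  by move/derivable_mxP : (df j z) => /(_ ord0 i).
have gK j z : `|'D_(delta_mx ord0 j) g z| <= K.
  by have := fK i j z; rewrite (derive_mx (df j z)) mxE.
pose p k : 'rV[R]_d := \row_j (if (j < k)%N then y ord0 j else x ord0 j).
have H k : (k <= d)%N -> `|g (p k) - g x| <= k%:R * K * `|x - y|.
  elim: k => [_|k IH kd].
    have -> : p 0%N = x by apply/rowP => j; rewrite mxE.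
    by rewrite subrr normr0 !mul0r.
  pose j := Ordinal kd.
  have pS : p k.+1 = p k + (y ord0 j - x ord0 j) *: delta_mx ord0 j.
    apply/rowP => l; rewrite !mxE eqxx /= ltnS leq_eqVlt.
    have -> : ((l : nat) == k) = (l == j) by rewrite -val_eqE.
    have [->|lj] := eqVneq l j; first by rewrite ltnn/= mulr1 addrC subrK.
    by rewrite /= mulr0 addr0.
  apply: le_trans (ler_distD (g (p k)) _ _) _.
  rewrite -natr1 mulrDl mulrDl mul1r addrC lerD ?IH 1?ltnW//.
  rewrite pS (le_trans (partial_bound_increment _ _ (dg j) (gK j)))//.
  by rewrite ler_wpM2l// distrC; have := le_coord_norm (x - y) j; rewrite !mxE.
have -> : f y ord0 i = g (p d).
  by congr (f _ _ _); apply/rowP => j; rewrite mxE ltn_ord.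
exact: H.
Qed.

End partials_lipschitz.

(** The operator norm bounds every entry of the Jacobian matrix; the factor [d] comes from changing
    [d] coordinates one after the other. *)
Lemma C1_field_lipschitz (R : realType) (d : nat) (T : R)
    (A : 'rV[R]_d -> R -> 'rV[R]_d) (K : R) : 0 <= K -> C1_field T A ->
  (forall x t, 0 <= t <= T -> opnorm (jacobian_x A x t) <= K) ->
  forall t, 0 <= t <= T ->
    forall x y, `|A x t - A y t| <= d%:R * K * `|x - y|.
Proof.
move=> K0 [_ dA _] AK t tT; apply: partials_lipschitz => // [j x|i j x].
  by have [+ _] := dA j; exact.
apply: le_trans (AK x t tT).
by have := coord_le_opnorm (jacobian_x A x t) i j; rewrite mxE.
Qed.

(** * The flow map: existence, uniqueness, continuity, inverse *)

Section flow.
Variables (R : realType) (d : nat) (T L : R) (T_ge0 : 0 <= T) (L_gt0 : 0 < L).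
Variable A : 'rV[R]_d -> R -> 'rV[R]_d.
Hypothesis A_lip : forall t, 0 <= t <= T ->
  forall x y, `|A x t - A y t| <= L * `|x - y|.
Hypothesis A_cont : {within slab T, continuous (fun p => A p.1 p.2)}.
Implicit Types (s : R -> 'rV[R]_d) (x y : 'rV[R]_d) (t : R).

Lemma ode_solution_trajectory t1 x s : ode_solution T A t1 x s ->
  trajectory T s (fun t => A (s t) t).
Proof.
move=> [_ Hs] j; apply: has_derivative_on_within => t /Hs H.
rewrite /is_derive_within.
have := cvg_comp _ _ H (@coord_continuous R 1 d ord0 j (A (s t) t)).
apply: cvg_trans; apply: near_eq_cvg; apply: nearW => u /=.
by rewrite !mxE.
Qed.

Lemma ode_solution_ex t1 x : 0 <= t1 <= T -> exists s, ode_solution T A t1 x s.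
Proof.
move=> t1T; have [s [s1 Hs]] := picard_lindelof T_ge0 L_gt0 A_lip A_cont x t1T.
exists s; split => // t tT; apply: is_derive_is_derive_within.
have ds : derivable s t 1.
  by apply/derivable_mxP => i j; rewrite (ord1 i); have [] := Hs t tT j.
split => //; rewrite derive_mx//; apply/rowP => j; rewrite mxE.
exact: (@derive_val _ _ _ _ _ _ _ (Hs t tT j)).
Qed.

(** Existence of a solution rules out the default value of [xget]. *)
Lemma flow_solution t1 x : 0 <= t1 <= T ->
  ode_solution T A t1 x (fun t => flow T A t1 t x).
Proof.
move=> t1T; exact: (xgetPex (fun=> x) (ode_solution_ex x t1T)).
Qed.

Lemma flow_lipschitz t1 t2 x y : 0 <= t1 <= T -> 0 <= t2 <= T ->
  `|flow T A t1 t2 x - flow T A t1 t2 y| <= 2 * weight (2 * L) t1 t2 * `|x - y|.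
Proof.
move=> t1T t2T; have Hx := flow_solution x t1T; have Hy := flow_solution y t1T.
rewrite mulrAC; apply: (trajectory_stable T_ge0 L_gt0 A_lip _
  (ode_solution_trajectory Hx) (ode_solution_trajectory Hy)) => //.
by rewrite (proj1 Hx) (proj1 Hy).
Qed.

Lemma flow_continuous t1 t2 : 0 <= t1 <= T -> 0 <= t2 <= T ->
  continuous (flow T A t1 t2).
Proof.
move=> t1T t2T x.
have FF : Filter (nbhs x) := nbhs_filter x.
apply/(@cvgrPdist_lt _ _ _ (nbhs x) FF) => e e0.
have w0 : 0 < 2 * weight (2 * L) t1 t2.
  by rewrite mulr_gt0// (lt_le_trans _ (weight_ge1 _ _ _)).
near=> y; apply: le_lt_trans (flow_lipschitz x y t1T t2T) _.
rewrite -ltr_pdivlMl// mulrC; near: y.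
have e1 : 0 < e / (2 * weight (2 * L) t1 t2) by exact: divr_gt0.
by have := nbhsx_ballx x _ e1; rewrite -ball_normE.
Unshelve. all: by end_near. Qed.

(** Stability with initial distance [D = 0]. *)
Lemma flow_unique t1 t2 x s : ode_solution T A t1 x s ->
  0 <= t1 <= T -> 0 <= t2 <= T -> flow T A t1 t2 x = s t2.
Proof.
move=> Hs t1T t2T; have Hx := flow_solution x t1T.
apply/eqP; rewrite -subr_eq0 -normr_le0.
have H0 : `|flow T A t1 t1 x - s t1| <= 0.
  by rewrite (proj1 Hx) (proj1 Hs) subrr normr0.
have := trajectory_stable T_ge0 L_gt0 A_lip (lexx 0)
  (ode_solution_trajectory Hx) (ode_solution_trajectory Hs) t1T H0 t2T.
by rewrite mulr0 mul0r.
Qed.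

(** The solution starting from [x] at [t1] is also the solution starting at [t2] from its own value
    there. *)
Lemma flowK t1 t2 : 0 <= t1 <= T -> 0 <= t2 <= T ->
  cancel (flow T A t1 t2) (flow T A t2 t1).
Proof.
move=> t1T t2T x; have [Hx1 Hx] := flow_solution x t1T.
by rewrite -[RHS]Hx1; apply: flow_unique.
Qed.

End flow.

(** * Borel sets, compact exhaustion and indicator test functions *)

Section borel_rV.
Variables (R : realType) (d : nat).
Local Notation mu := (lebesgue_rV R d).
Implicit Types (A B : set 'rV[R]_d).

Lemma closed_measurable_rV A : closed A -> measurable A.
Proof.
move=> cA; rewrite -(setCK A); apply: measurableC.
by apply: open_measurable_rV; exact: closed_openC.
Qed.

Lemma continuous_measurable_rV (f : 'rV[R]_d -> 'rV[R]_d) :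
  continuous f -> measurable_fun setT f.
Proof.
move=> cf; apply: (measurability [set A : set 'rV[R]_d | open A] erefl).
move=> _ [U /= oU <-]; rewrite setTI; apply: open_measurable_rV.
by move/continuousP : cf => /(_ _ oU).
Qed.

Lemma norm_le_box (r : R) : 0 <= r ->
  [set x : 'rV[R]_d | `|x| <= r] = [set x | forall j, `[- r, r]%classic (x ord0 j)].
Proof.
move=> r0; apply/seteqP; split=> x /= H.
  by move=> j; rewrite /= in_itv/= -ler_norml (le_trans (le_coord_norm _ _)).
by apply: rV_norm_le => // j; have := H j; rewrite /= in_itv/= -ler_norml.
Qed.

Lemma measurable_norm_le (r : R) : 0 <= r ->
  measurable [set x : 'rV[R]_d | `|x| <= r].
Proof.
move=> r0; rewrite norm_le_box//.
by apply: (@measurable_box _ _ (fun=> `[- r, r]%classic)) => j.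
Qed.

Lemma lebesgue_rV_bounded A : measurable A -> bounded_set A -> (mu A < +oo)%E.
Proof.
move=> mA [M [_ HM]]; pose r := `|M| + 1.
have r0 : 0 <= r by rewrite addr_ge0.
have Ar : A `<=` [set x | `|x| <= r].
  move=> x Ax; apply: (HM r) => //.
  by rewrite (le_lt_trans (ler_norm _))// ltrDl.
apply: le_lt_trans (_ : (_ <= mu [set x | (`|x| <= r)%R])%E) _.
  by apply: le_measure => //; rewrite inE//; exact: measurable_norm_le.
rewrite norm_le_box// (@lebesgue_rV_box _ _ (fun=> `[- r, r]%classic))//.
rewrite (eq_bigr (fun=> (r - - r)%:E)) => [|i _].
  by rewrite prodEFin ltry.
rewrite lebesgue_measure_itv/= lte_fin -EFinB; case: ifPn => //.
by rewrite -leNgt => rN; congr EFin; lra.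
Qed.

Lemma compact_exhaustion (Omega : set 'rV[R]_d) :
  open Omega -> bounded_set Omega ->
  exists K : nat -> set 'rV[R]_d,
    [/\ forall n, compact (K n), forall n, K n `<=` Omega &
        forall x, Omega x -> exists N, forall n, (N <= n)%N -> K n x].
Proof.
move=> oO bO.
(* Points at distance at least 1/(n+1) from the complement, written as an intersection of
   complements of open balls, hence closed. *)
pose K n := [set x : 'rV[R]_d | forall z, ~ Omega z -> n.+1%:R^-1 <= `|x - z|].
have KO n : K n `<=` Omega.
  move=> x Kx; apply: contrapT => /Kx; rewrite subrr normr0.
  by rewrite leNgt invr_gt0 ltr0n.
exists K; split => // [n|x Ox].
  apply: bounded_closed_compact.
    have [M [Mr HM]] := bO; exists M; split => // N MN x Kx.
    by apply: HM => //; exact: KO Kx.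
  have -> : K n = \bigcap_(z in ~` Omega) [set x | n.+1%:R^-1 <= `|x - z|].
    by apply/seteqP; split=> x H z; exact: H.
  apply: closed_bigI => z _.
  have -> : [set x | n.+1%:R^-1 <= `|x - z|] = ~` ball z n.+1%:R^-1.
    apply/seteqP; split=> x /=; rewrite -ball_normE /= distrC.
      by rewrite leNgt => /negP.
    by move/negP; rewrite -leNgt.
  by apply: open_closedC; apply: ball_open; rewrite invr_gt0 ltr0n.
move: oO; rewrite openE => /(_ _ Ox) /nbhs_ballP[e /= e0 eO].
have [N _ HN] := near_infty_natSinv_lt (PosNum e0).
exists N => n Nn z; apply: contra_notP => /negP; rewrite -ltNge => xz.
apply: eO; rewrite -ball_normE /=.
exact: lt_trans xz (HN n Nn).
Qed.

Lemma ess_support_closed (f : 'rV[R]_d -> R) : closed (ess_support f).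
Proof.
rewrite -[ess_support f]setCK; apply: open_closedC; rewrite openE => x /=.
move=> /existsNP[V /not_implyP[xV /contrapT f0]].
have := nbhs_interior xV; apply: filterS => y yV /(_ V yV); exact.
Qed.

(** The essential support may leave [E], but not the closed set [K], off which the indicator
    vanishes; being closed in [K], it is compact. *)
Lemma indic_H0 (Omega K E : set 'rV[R]_d) : compact K -> K `<=` Omega ->
  measurable E -> E `<=` K -> H0 Omega (\1_E).
Proof.
move=> cK KO mE EK.
have sK : ess_support (\1_E : 'rV[R]_d -> R) `<=` K.
  have clK : closed K by apply: compact_closed => //; exact: norm_hausdorff.
  move=> x sx; apply: contrapT => nKx.
  have : nbhs x (~` K) by apply: open_nbhs_nbhs; split => //; exact: closed_openC.
  move=> /sx; apply; apply: aeW => y nKy.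
  by rewrite indicE memNset// => /EK.
split.
- rewrite /L2 patch_setT; apply/andP; split.
    by rewrite inE /=; exact: measurable_indic.
  rewrite inE /= /finite_norm unlock poweR_lty//.
  rewrite (eq_integral (fun x => (\1_E x)%:E)) => [|x _].
    rewrite integral_indic// setIT lebesgue_rV_bounded//.
    have [M [Mr HM]] := compact_bounded cK; exists M; split => // N MN x Ex.
    by apply: HM => //; exact: EK.
  rewrite /= indicE; case: (x \in E) => /=; rewrite ?normr1 ?normr0.
    by rewrite ?poweR_EFin powR1.
  by rewrite ?poweR_EFin powR0.
- apply: subclosed_compact sK => //; exact: ess_support_closed.
- exact: subset_trans sK KO.
Qed.

End borel_rV.

(** The function [f - g] is positive on [Q] and has integral zero there, so [Q] is negligible.
    Boundedness on a set of finite measure gives the integrability needed to subtract the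
    integrals. *)
Lemma ae_not_of_eq_integral d (X : measurableType d) (R : realType)
    (mu : {measure set X -> \bar R}) (Q : set X) (f g : X -> R) (C : R) :
  measurable Q -> (mu Q < +oo)%E ->
  measurable_fun setT f -> measurable_fun setT g ->
  (forall x, Q x -> `|f x| <= C) -> (forall x, Q x -> `|g x| <= C) ->
  (forall x, Q x -> g x < f x) ->
  \int[mu]_(x in Q) f x = \int[mu]_(x in Q) g x ->
  {ae mu, forall x, ~ Q x}.
Proof.
move=> mQ Qoo mf mg fC gC gf fg.
have int (h : X -> R) : measurable_fun setT h -> (forall x, Q x -> `|h x| <= C) ->
    mu.-integrable Q (EFin \o h).
  move=> mh hC; apply: measurable_bounded_integrable => //.
    exact: measurable_funTS.
  exists C; split; first exact: num_real.
  by move=> M CM x /hC /le_trans; apply; exact: ltW.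
have fgi : mu.-integrable Q (EFin \o (f \- g)).
  by have := integrableB mQ (int _ mf fC) (int _ mg gC).
have E0 : (\int[mu]_(x in Q) `|(f x - g x)%:E| = 0)%E.
  transitivity (\int[mu]_(x in Q) (f x - g x)%:E)%E.
    apply: eq_integral => x; rewrite inE => Qx.
    by rewrite gee0_abs// lee_fin subr_ge0 ltW// gf.
  rewrite -[LHS]fineK; last exact: integrable_fin_num fgi.
  by rewrite -/(Rintegral mu Q (fun x => f x - g x)) RintegralB ?int// fg subrr.
have mfg : measurable_fun Q (EFin \o (f \- g)).
  by apply/measurable_EFinP/measurable_funTS; exact: measurable_funB.
have /(ae_eq_integral_abs mu mQ mfg) := E0.
apply: filterS => x H Qx; move: (H Qx) => /= -[] /eqP.
by rewrite subr_eq0 gt_eqF// gf.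
Qed.

Lemma L2_measurable (R : realType) (d : nat) (G : set 'rV[R]_d) f :
  L2 G f -> measurable_fun setT (f \_ G).
Proof. by move=> /sub_Lfun_mfun; rewrite inE. Qed.

(** * Uniqueness, from the continuity and invertibility of the flow *)

Section uniqueness.
Variables (R : realType) (d : nat) (T : R) (Omega : set 'rV[R]_d).
Variable A : 'rV[R]_d -> R -> 'rV[R]_d.
Variable U0 : 'rV[R]_d -> R.
Hypothesis T_ge0 : 0 <= T.
Hypothesis flow_cont : forall t1 t2, 0 <= t1 <= T -> 0 <= t2 <= T ->
  continuous (flow T A t1 t2).
Hypothesis flow_cancel : forall t1 t2, 0 <= t1 <= T -> 0 <= t2 <= T ->
  cancel (flow T A t1 t2) (flow T A t2 t1).
Local Notation mu := (lebesgue_rV R d).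
Local Notation Omt := (moving_domain T A Omega).
Implicit Types (U V : 'rV[R]_d -> R -> R).

Let zero_itv : 0 <= (0 : R) <= T. Proof. by rewrite lexx. Qed.
Let T_itv : 0 <= T <= T. Proof. by rewrite T_ge0 lexx. Qed.

Lemma restrict_mul_test Psi f t :
  (fun x => f x * test_function T A Psi x t) \_ (Omt t) =
  (fun x => (f \_ (Omt t)) x * Psi (flow T A t T x)).
Proof.
by apply/funext => x; rewrite /test_function !patchE; case: ifPn; rewrite ?mul0r.
Qed.

Lemma test_integral_eq U V Psi t : is_solution T A Omega U0 U ->
  is_solution T A Omega U0 V -> H0 Omega Psi -> 0 <= t <= T ->
  \int[mu]_x (((U ^~ t) \_ (Omt t)) x * Psi (flow T A t T x)) =
  \int[mu]_x (((V ^~ t) \_ (Omt t)) x * Psi (flow T A t T x)).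
Proof.
move=> [[LU _] U0E HU] [[LV _] V0E HV] HPsi tT.
have cst_int W : (forall t, 0 <= t <= T -> is_derive_within `[0, T]
      (fun s => \int[mu]_(x in Omt s) (W x s * test_function T A Psi x s) : R^o)
      t 0) ->
    \int[mu]_x (((W ^~ t) \_ (Omt t)) x * Psi (flow T A t T x)) =
    \int[mu]_x (((W ^~ 0) \_ (Omt 0)) x * Psi (flow T A 0 T x)).
  move=> /has_derivative_on_within HW.
  have := has_derivative_on_cst HW zero_itv tT.
  by rewrite !(Rintegral_mkcond _ (Omt _)) !restrict_mul_test.
rewrite (cst_int _ (HU _ HPsi)) (cst_int _ (HV _ HPsi)).
(* At time 0 the integrands agree almost everywhere; equality of the integrals also requires both to
   be measurable. *)
have mPsi : measurable_fun setT (fun x => Psi (flow T A 0 T x)).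
  apply: (measurableT_comp (f := Psi)).
    by case: HPsi => /L2_measurable; rewrite patch_setT.
  by apply: continuous_measurable_rV; exact: flow_cont.
congr fine; apply: ae_eq_integral => //.
- apply/measurable_EFinP; apply: measurable_funM => //.
  by apply: L2_measurable; exact: LU.
- apply/measurable_EFinP; apply: measurable_funM => //.
  by apply: L2_measurable; exact: LV.
move: U0E V0E; apply: filterS2 => x Ux Vx _; congr (EFin (_ * _)).
by rewrite !patchE; case: ifPn => // /[!inE] xO; rewrite Ux// Vx.
Qed.

Hypothesis Omega_open : open Omega.
Hypothesis Omega_bounded : bounded_set Omega.

(* Test against the indicator of the set where U exceeds V, cut down so that
   its transport by the flow to time T lies in a compact subset of Omega. *)
Lemma solution_ae_le U V t : is_solution T A Omega U0 U ->
  is_solution T A Omega U0 V -> 0 <= t <= T ->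
  {ae mu, forall x, Omt t x -> U x t <= V x t}.
Proof.
move=> Usol Vsol tT.
have [K [cK KO KE]] := compact_exhaustion Omega_open Omega_bounded.
pose f := (U ^~ t) \_ (Omt t); pose g := (V ^~ t) \_ (Omt t).
have mf : measurable_fun setT f.
  by apply: L2_measurable; case: Usol => -[+ _] _ _; exact.
have mg : measurable_fun setT g.
  by apply: L2_measurable; case: Vsol => -[+ _] _ _; exact.
(* The bounds by [n] give integrability and finite measure; the preimage of [K n] makes the test
   function admissible. Together the sets [Q n] cover the part of the moving domain where [U]
   exceeds [V]. *)
pose Q n := [set x | [/\ g x < f x, `|f x| <= n%:R, `|g x| <= n%:R & `|x| <= n%:R]]
  `&` flow T A t T @^-1` K n.
have mflow t1 t2 : 0 <= t1 <= T -> 0 <= t2 <= T ->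
    measurable_fun setT (flow T A t1 t2).
  by move=> *; apply: continuous_measurable_rV; exact: flow_cont.
have mQ n : measurable (Q n).
  apply: measurableI.
    rewrite (_ : mkset _ = (f \- g) @^-1` `]0, +oo[ `&` f @^-1` `[- n%:R, n%:R] `&`
        g @^-1` `[- n%:R, n%:R] `&` [set x | `|x| <= n%:R]); last first.
      apply/seteqP; split=> x /=; rewrite !in_itv/= andbT subr_gt0 -!ler_norml.
        by move=> [].
      by move=> [[[]]].
    apply: measurableI; last exact: measurable_norm_le.
    rewrite -[X in measurable (X `&` _ `&` _)]setTI.
    rewrite -[X in measurable (_ `&` X `&` _)]setTI.
    rewrite -[X in measurable (_ `&` _ `&` X)]setTI.
    apply: measurableI; first apply: measurableI.
    - by apply: measurable_funB.
    - exact: mf.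
    - exact: mg.
  rewrite -[X in measurable X]setTI; apply: mflow => //.
  apply: closed_measurable_rV.
  by apply: compact_closed (cK n); exact: norm_hausdorff.
have Qoo n : (mu (Q n) < +oo)%E.
  apply: lebesgue_rV_bounded => //; exists n%:R; split; first exact: num_real.
  by move=> M nM x [[_ _ _ xn] _]; exact: le_trans xn (ltW nM).
have intQ n : \int[mu]_(x in Q n) f x = \int[mu]_(x in Q n) g x.
  (* [E] is the transport of [Q n] to time [T], taken as a preimage under the inverse flow so that
     it is Borel; its indicator composed with the flow is that of [Q n]. *)
  pose E := flow T A T t @^-1` Q n.
  have mE : measurable E by rewrite -[E]setTI; exact: mflow.
  have EK : E `<=` K n by move=> y [_] /=; rewrite flow_cancel.
  have := test_integral_eq Usol Vsol (indic_H0 (cK n) (@KO n) mE EK) tT.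
  have EQ (h : 'rV[R]_d -> R) :
      h \_ (Q n) = (fun x => h x * \1_E (flow T A t T x)).
    apply/funext => x; rewrite patch_indic /= !indicE.
    congr (_ * (nat_of_bool _)%:R).
    by apply/idP/idP; rewrite !inE /E /= flow_cancel.
  by rewrite !(Rintegral_mkcond _ (Q n)) !EQ.
have aeQ n : {ae mu, forall x, ~ Q n x}.
  by apply: (ae_not_of_eq_integral (C := n%:R) (mQ n) (Qoo n) mf mg _ _ _ (intQ n))
    => x [[]].
apply: filterS (ae_foralln aeQ) => x nQ Ox; rewrite leNgt; apply/negP => VU.
have [y Oy yx] := Ox; have [N KN] := KE y Oy.
(* One index large enough for the three bounds and for [K n] to contain [y], the transport of [x] to
   time [T]. *)
pose n := maxn N (Num.truncn (`|f x| + `|g x| + `|x|)).+1.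
have ln : `|f x| + `|g x| + `|x| <= n%:R.
  by rewrite (le_trans (ltW (truncnS_gt _)))// ler_nat leq_maxr.
have f0 := normr_ge0 (f x); have g0 := normr_ge0 (g x); have x0 := normr_ge0 x.
apply: (nQ n); split; last first.
  by rewrite /= -yx flow_cancel//; apply: KN; rewrite leq_maxl.
split; [|lra..].
by rewrite /f /g !patchE mem_set.
Qed.

End uniqueness.

Theorem theorem5p3 (R : realType) (d : nat) (d_ge1 : (1 <= d)%N)
    (T : R) (T_gt0 : 0 < T)
    (Omega : set 'rV[R]_d) (Omega_open : open Omega)
    (Omega_bounded : bounded_set Omega)
    (A : 'rV[R]_d -> R -> 'rV[R]_d) (A_C1 : C1_field T A)
    (LA : R) (LA_gt0 : 0 < LA)
    (A_lip : forall x t, 0 <= t <= T -> opnorm (jacobian_x A x t) <= LA)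
    (U0 : 'rV[R]_d -> R) (U0_L2 : L2 (moving_domain T A Omega 0) U0)
    (U V : 'rV[R]_d -> R -> R)
    (U_sol : is_solution T A Omega U0 U) (V_sol : is_solution T A Omega U0 V)
    (t : R) (t_0T : 0 <= t <= T) :
  (U ^~ t) = (V ^~ t) %[ae lebesgue_rV R d in moving_domain T A Omega t].
Proof.
have T0 := ltW T_gt0.
(* The Lipschitz constant in the maximum norm; it is positive because [d] is at least 1. *)
have L0 : 0 < d%:R * LA by rewrite mulr_gt0// ltr0n.
have lipA := C1_field_lipschitz (ltW LA_gt0) A_C1 A_lip.
have [contA _ _] := A_C1.
have cflow t1 t2 := @flow_continuous _ _ _ _ T0 L0 _ lipA contA t1 t2.
have flow_cancel t1 t2 := @flowK _ _ _ _ T0 L0 _ lipA contA t1 t2.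
(* The hypotheses are symmetric in [U] and [V], so the one-sided inequality holds both ways. *)
have UV := solution_ae_le T0 cflow flow_cancel Omega_open Omega_bounded
  U_sol V_sol t_0T.
have VU := solution_ae_le T0 cflow flow_cancel Omega_open Omega_bounded
  V_sol U_sol t_0T.
move: UV VU; apply: filterS2 => x UV VU Ox.
by apply/eqP; rewrite eq_le UV// VU.
Qed.
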